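(* There exists $n_0$ such that for every integer $n \geq n_0$ the following holds. Let $\varepsilon = \varepsilon(n) \geq 4 n^{-1/4}$ and let $t = t(n) \leq \varepsilon^2 \sqrt{n}/5$ be a positive integer. If $q \leq (1-\varepsilon) n$ is a positive integer, then in the $(1:q)$ Waiter-Client game played on $E(K_n)$, Waiter has a strategy to force Client to build a graph which admits a $K_t$-minor. On the other hand, if $q \geq n + \eta$, where $\eta = \eta(n) \geq n^{2/3}\log n$, then in the $(1:q)$ Waiter-Client game played on $E(K_n)$, Client has a strategy to ensure that his graph is $K_4$-minor free throughout the game.
   Context: $\log$ denotes the natural logarithm. The $(1:q)$ Waiter-Client game on the board $X = E(K_n)$ (the edge set of the complete graph on $n$ vertices) is played as follows: in each round Waiter offers Client $q+1$ previously unoffered (free) edges; Client claims one of them and Waiter claims the remaining $q$. If in the final round only $1 \le r < q+1$ free edges remain, Client claims $\max\{0, r-q\}$ of them and Waiter claims the rest. The game ends when all edges are claimed. Client's graph is the graph on $V(K_n)$ formed by the edges Client claimed. A graph $G$ admits a $K_t$-minor if there exist pairwise disjoint vertex sets $B_1,\dots,B_t \subseteq V(G)$ such that each $G[B_i]$ is connected and for every $i<j$ there is an edge of $G$ between $B_i$ and $B_j$. *)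

(* Defs.v *)
From mathcomp Require Import all_boot.

Set Implicit Arguments.
Unset Strict Implicit.
Unset Printing Implicit Defensive.

(* A round records the set offered by Waiter and the subset of it claimed by
   Client, Waiter receiving the rest; histories list the latest round first. *)
Definition round (T : finType) : Type := ({set T} * {set T})%type.
Definition history (T : finType) : Type := seq (round T).

Section WaiterClient.

Variables (T : finType) (X : {set T}) (q : nat).
Implicit Types (h : history T) (A C : {set T}).

Definition offered h : {set T} := \bigcup_(r <- h) r.1.
Definition client_claimed h : {set T} := \bigcup_(r <- h) r.2.
Definition free_elts h : {set T} := X :\: offered h.
Definition game_over h : bool := free_elts h == set0.

(* When r < q.+1 elements are left, the final round offers all of them. *)
Definition legal_offer h A : bool :=
  (A \subset free_elts h) && (#|A| == minn q.+1 #|free_elts h|).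

(* With truncated subtraction, #|A| - q is 1 in a full round (#|A| = q.+1) and
   max {0, r - q} in a final round with r elements. *)
Definition legal_claim A C : bool := (C \subset A) && (#|C| == #|A| - q).

Definition waiter_strategy : Type := history T -> {set T}.
Definition client_strategy : Type := history T -> {set T} -> {set T}.

Inductive waiter_play (S : waiter_strategy) : history T -> Prop :=
| waiter_play_start : waiter_play S [::]
| waiter_play_round h C :
    waiter_play S h -> ~~ game_over h -> legal_claim (S h) C ->
    waiter_play S ((S h, C) :: h).

Inductive client_play (S : client_strategy) : history T -> Prop :=
| client_play_start : client_play S [::]
| client_play_round h A :
    client_play S h -> ~~ game_over h -> legal_offer h A ->
    client_play S ((A, S h A) :: h).

Definition waiter_can_force (P : {set T} -> Prop) : Prop :=
  exists S : waiter_strategy,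
    (forall h, waiter_play S h -> ~~ game_over h -> legal_offer h (S h)) /\
    (forall h, waiter_play S h -> game_over h -> P (client_claimed h)).

Definition client_can_maintain (P : {set T} -> Prop) : Prop :=
  exists S : client_strategy,
    (forall h A, client_play S h -> ~~ game_over h -> legal_offer h A ->
       legal_claim A (S h A)) /\
    (forall h, client_play S h -> P (client_claimed h)).

End WaiterClient.

Definition complete_edges (n : nat) : {set {set 'I_n}} :=
  [set e : {set 'I_n} | #|e| == 2].

Definition graph_of_edges (V : finType) (E : {set {set V}}) : rel V :=
  [rel x y | (x != y) && ([set x; y] \in E)].

(* Connectedness of the induced subgraph e[B]; as usual, the null graph is not
   connected, so that branch sets of minors are nonempty. *)
Definition connected_on (V : finType) (e : rel V) (B : {set V}) : Prop :=
  B != set0 /\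
  forall x y, x \in B -> y \in B ->
    connect [rel u v | [&& u \in B, v \in B & e u v]] x y.

Definition has_complete_minor (V : finType) (e : rel V) (t : nat) : Prop :=
  exists B : 'I_t -> {set V},
    (forall i, connected_on e (B i)) /\
    (forall i j : 'I_t, i < j ->
       [disjoint B i & B j] /\
       exists x y, [/\ x \in B i, y \in B j & e x y]).

(* Main.v *)
Require Import Defs.
From mathcomp Require Import all_boot all_order all_algebra.
From mathcomp Require Import zify ring lra.
From mathcomp Require Import boolp reals sequences exp.

(** Waiter's side. Fix [K] close to [2 / eps] and [d] close to
    [sqrt (n / 2)]. Waiter forces a path [p_0, p_1, ...] with [t * d * K]
    vertices by offering, in round [i], only edges from [p_i] to unvisited
    vertices not congruent to [i] modulo [K] (vertices are numbers below [n]).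
    So [p_i p_j], [i < j], is still free whenever [p_j] is congruent to [i].
    Cut the path into [t] segments of [d * K] vertices: each vertex of a later
    segment keeps [d] free edges to each earlier one, so every two segments
    are joined by [K * d ^ 2 > q] free edges, and offering [q + 1] of these
    makes Client join them.

    Client's side. A graph with a [K_4]-minor has a vertex set [W] spanning
    more than [#|W|] edges. A longest path in a minimal such [W] has, at its
    two ends, two distinct chords back to the path (otherwise it closes up to
    a cycle which is a component and can be removed from [W]). There are at
    most [n ^ k * k ^ 2] such configurations on [k] vertices, each with
    [k + 1] edges, so the sum of [(q + 1) ^ - (k + 1)] over all of them is
    below 1, and Client avoids them by never increasing the conditional
    expectation of the number of configurations claimed in random play. *)

Set Implicit Arguments.
Unset Strict Implicit.
Unset Printing Implicit Defensive.

Import Order.TTheory GRing.Theory Num.Theory.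

(** * Forcing positions *)

Lemma subset_of_card (T : finType) (F : {set T}) k :
  k <= #|F| -> exists2 A : {set T}, A \subset F & #|A| = k.
Proof.
move=> kF; exists [set x in take k (enum F)].
  by apply/subsetP => x; rewrite inE => /mem_take; rewrite mem_enum.
rewrite cardsE (card_uniqP _) ?take_uniq ?enum_uniq // size_take -cardE.
by case: ltngtP kF.
Qed.

Section Forcing.
Variables (T : finType) (X : {set T}) (q : nat).
Implicit Types (h : history T) (A C : {set T}) (P : {set T} -> Prop).

(** Winning positions as well-founded game trees. Phases of Waiter's play can thus be composed by
    induction before any function of the history is chosen. *)
Inductive forces P : history T -> Prop :=
| forces_over h : game_over X h -> P (client_claimed h) -> forces P h
| forces_offer h A : ~~ game_over X h -> legal_offer X q h A ->
    (forall C, legal_claim q A C -> forces P ((A, C) :: h)) -> forces P h.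

(** Waiter picks an offer all of whose legal answers lead to forcing positions again, so every
    position reached is forcing. *)
Lemma waiter_can_force_of_forces P :
  forces P [::] -> waiter_can_force X q P.
Proof.
move=> f0.
pose good h A := legal_offer X q h A &&
  `[< forall C, legal_claim q A C -> forces P ((A, C) :: h) >].
pose S h := odflt set0 [pick A | good h A].
have S_good h : forces P h -> ~~ game_over X h -> good h (S h).
  move=> fh nover; rewrite /S; case: pickP => //= nogood.
  case: fh nover nogood => {h} [h -> //|h A _ lA fA _ /(_ A)].
  by rewrite /good lA /=; move/asboolP; case.
have Sforces h : waiter_play X q S h -> forces P h.
  elim=> {h} // h C _ fh nover lC.
  by have /andP[_ /asboolP] := S_good h fh nover; apply.
exists S; split=> h /Sforces fh over.
  by have /andP[] := S_good h fh over.
by case: fh over => // {}h A /negPf ->.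
Qed.

Lemma client_claimed_cons A C h :
  client_claimed ((A, C) :: h) = C :|: client_claimed h.
Proof. by rewrite /client_claimed big_cons. Qed.

Lemma offered_cons A C h : offered ((A, C) :: h) = A :|: offered h.
Proof. by rewrite /offered big_cons. Qed.

Lemma free_elts_cons A C h :
  free_elts X ((A, C) :: h) = free_elts X h :\: A.
Proof.
by rewrite /free_elts offered_cons; apply/setP=> x; rewrite !inE negb_or -andbA.
Qed.

(** Any legal offers will do: each round shrinks the free set, and Client's set only grows. *)
Lemma forces_up P h :
  (forall C, client_claimed h \subset C -> P C) -> forces P h.
Proof.
have [m] := ubnP #|free_elts X h|; elim: m h => // m IHm h lt_m up.
have [over|nover] := boolP (game_over X h).
  by apply: forces_over => //; apply: up.
have [A sAF cA] := subset_of_card (geq_minr q.+1 #|free_elts X h|).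
apply: (@forces_offer _ _ A) => // [|C /andP[_ _]].
  by rewrite /legal_offer sAF cA eqxx.
apply: IHm => [|C']; last first.
  by rewrite client_claimed_cons subUset => /andP[_]; apply: up.
rewrite free_elts_cons cardsD (setIidPr sAF) cA.
have : 0 < #|free_elts X h| by rewrite card_gt0.
lia.
Qed.

Lemma forces_round P h A :
  A \subset free_elts X h -> #|A| = q.+1 ->
  (forall c, c \in A -> forces P ((A, [set c]) :: h)) -> forces P h.
Proof.
move=> sAF cA fA; have leF := subset_leq_card sAF.
apply: (@forces_offer _ _ A) => [||C].
- by rewrite /game_over -card_gt0; lia.
- by rewrite /legal_offer sAF /=; apply/eqP; lia.
case/andP=> sCA; rewrite cA subSnn => /cards1P[c Cc].
by rewrite Cc; apply: fA; rewrite -sub1set -Cc.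
Qed.

(** Waiter offers [q.+1] elements of each [F i] in turn; disjointness keeps the later families
    free. *)
Lemma forces_transversal (I : eqType) (F : I -> {set T}) (l : seq I) P h :
  uniq l -> (forall i, i \in l -> q < #|F i|) ->
  (forall i, i \in l -> F i \subset free_elts X h) ->
  (forall i j, i \in l -> j \in l -> i != j -> [disjoint F i & F j]) ->
  (forall C, client_claimed h \subset C ->
     (forall i, i \in l -> exists2 c, c \in F i & c \in C) -> P C) ->
  forces P h.
Proof.
elim: l h => [|i l IHl] h /=.
  by move=> _ _ _ _ PC; apply: forces_up => C sC; apply: PC.
case/andP=> il ul big free disj PC.
have [A sAF cA] := subset_of_card (big i (mem_head _ _)).
apply: (@forces_round _ _ A) => // [|c cinA].
  exact: subset_trans sAF (free _ (mem_head _ _)).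
have inl j : j \in l -> j \in i :: l by rewrite inE orbC => ->.
apply: IHl => // [j /inl/big //|j jl|j k /inl jl /inl kl|C].
- rewrite free_elts_cons subsetD free ?inl //=.
  rewrite disjoint_sym; apply: disjointWl sAF _; apply: disj.
  + exact: mem_head.
  + exact: inl.
  + by apply: contraNneq il => ->.
- exact: disj.
rewrite client_claimed_cons subUset sub1set => /andP[cC sC] meets.
apply: PC => // j; rewrite inE => /predU1P[->|/meets //].
by exists c; rewrite ?(subsetP sAF).
Qed.

End Forcing.

(** * Forcing a path and a minor *)

Lemma graph_of_edges_sym (V : finType) (E : {set {set V}}) :
  symmetric (graph_of_edges E).
Proof. by move=> x y; rewrite /graph_of_edges /= eq_sym setUC. Qed.

Lemma set2_inj (T : finType) (a b c d : T) :
  [set a; b] = [set c; d] -> (a = c /\ b = d) \/ (a = d /\ b = c).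
Proof.
move=> eq; have: a \in [set c; d] by rewrite -eq !inE eqxx.
have: b \in [set c; d] by rewrite -eq !inE eqxx orbT.
have: c \in [set a; b] by rewrite eq !inE eqxx.
have: d \in [set a; b] by rewrite eq !inE eqxx orbT.
rewrite !inE.
by do 4![case/predU1P=> [?|/eqP ?]]; subst; auto.
Qed.

Lemma card_residue_class n K r :
  0 < K -> #|[set u : 'I_n | u %% K == r]| <= (n %/ K).+1.
Proof.
move=> K0; rewrite -[X in _ <= X]card_ord.
pose f (u : 'I_n) : 'I_(n %/ K).+1 := inord (u %/ K).
rewrite -(@card_in_imset _ _ f) ?max_card // => u v; rewrite !inE.
move=> /eqP ur /eqP vr /(congr1 val); rewrite /= !inordK.
- by move=> eq; apply: val_inj; rewrite /= (divn_eq u K) (divn_eq v K) eq ur vr.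
- by rewrite ltnS leq_div2r // ltnW.
- by rewrite ltnS leq_div2r // ltnW.
Qed.

Lemma index_rcons_mem (T : eqType) (p : seq T) x y :
  x \in p -> index x (rcons p y) = index x p.
Proof. by move=> xp; rewrite -cats1 index_cat xp. Qed.

Lemma index_rcons_ge (T : eqType) (p : seq T) x y :
  index x p <= index x (rcons p y).
Proof.
rewrite -cats1 index_cat; case: ifP => // /negbT/memNindex->.
exact: leq_addr.
Qed.

Section PathPhase.
Variables (n K q : nat) (x0 : 'I_n) (P : {set {set 'I_n}} -> Prop).
Implicit Types (h : history {set 'I_n}) (p : seq 'I_n).

(* Vertex number [i] of the path is never offered together with a vertex
   congruent to [i] modulo [K]. *)
Definition path_state h p :=
  [/\ uniq (x0 :: p),
      path (graph_of_edges (client_claimed h)) x0 p &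
      forall e, e \in offered h -> exists x u,
        [/\ e = [set x; u], index x (x0 :: p) < index u (x0 :: p),
            index x (x0 :: p) < size p & u %% K != index x (x0 :: p) %% K]].

(** Waiter offers edges from the end of the path, at position [size p], to unvisited vertices
    outside the residue class of [size p]. Now [size p + 1] vertices are visited and at most
    [n %/ K + 1] lie in the class, so more than [q] remain. *)
Lemma path_phase k p h :
  0 < K -> path_state h p -> size p + k + n %/ K + q + 2 <= n ->
  (forall h' p', path_state h' p' -> size p' = size p + k ->
     forces (complete_edges n) q P h') ->
  forces (complete_edges n) q P h.
Proof.
move=> K0; elim: k p h => [|k IHk] p h st le_n next.
  by apply: (next h p) => //; rewrite addn0.
have [us ps off] := st.
pose z := last x0 p; pose s := x0 :: p.
have zs : z \in s by apply: mem_last.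
have iz : index z s = size p by rewrite /z index_last.
pose U := [set u | (u \notin s) && (u %% K != size p %% K)].
have memU u : (u \in U) = (u \notin s) && (u %% K != size p %% K).
  by rewrite in_set.
have cU : q < #|U|.
  have : #|~: U| <= #|[set x in s]| + #|[set u : 'I_n | u %% K == size p %% K]|.
    rewrite (leq_trans _ (leq_card_setU _ _)) // subset_leq_card //.
    by apply/subsetP => u; rewrite !inE negb_and !negbK.
  have := card_residue_class n (size p %% K) K0.
  have -> : #|[set x in s]| = (size p).+1 by rewrite cardsE (card_uniqP us).
  have := cardsC U; rewrite card_ord.
  by lia.
have injz : {in U &, injective (fun u => [set z; u])}.
  move=> u v; rewrite !memU => /andP[us' _] _ /set2_inj[[]//|[_ uz]].
  by rewrite uz zs in us'.
have [A sA cA] : exists2 A : {set {set 'I_n}},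
    A \subset [set [set z; u] | u in U] & #|A| = q.+1.
  by apply: subset_of_card; rewrite card_in_imset.
apply: (@forces_round _ _ _ _ _ A) => // [|c cAc].
  apply/subsetP => e /(subsetP sA) /imsetP[u]; rewrite memU => /andP[us' _] ->.
  rewrite !inE cards2.
  have -> /= : z != u by apply: contraNneq us' => <-.
  (* An edge offered earlier has its first end at a position below [size p], whereas [z] is at
     [size p] and [u] is off the path. *)
  rewrite andbT; apply/negP => /off[x [u' [/set2_inj eq lt1 lt2 _]]].
  case: eq => -[zx uu]; first by move: lt2; rewrite -zx iz ltnn.
  move: lt1; rewrite -zx -uu -/s iz => lt1.
  by move: us'; rewrite -index_mem (ltn_trans lt1).
have /imsetP[w] := subsetP sA _ cAc; rewrite memU => /andP[ws wK] cE.
apply: (IHk (rcons p w)) => [||h' p' st' szp'].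
- split.
  + by rewrite -rcons_cons rcons_uniq ws.
  + rewrite rcons_path; apply/andP; split.
      apply: sub_path ps => x y /andP[xy exy].
      by rewrite /graph_of_edges /= xy client_claimed_cons in_setU exy orbT.
    rewrite /graph_of_edges /= client_claimed_cons !inE -cE eqxx andbT.
    by apply: contraNneq ws; rewrite -/z => <-.
  (* In a new offer [u] has larger index than [z] whether Client chose it (it is then last) or not
     ([index] then returns the size). *)
  + move=> e; rewrite offered_cons inE => /orP[/(subsetP sA)/imsetP[u uU ->]|].
      exists z, u; move: uU; rewrite memU => /andP[us' uK].
      rewrite -rcons_cons size_rcons index_rcons_mem // -/s iz; split=> //.
      rewrite (leq_trans _ (index_rcons_ge _ _ _)) //.
      by rewrite (memNindex us').
    move/off => [x [u [-> lt1 lt2 uK]]]; exists x, u.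
    have xs : x \in s by rewrite -index_mem (ltn_trans lt2).
    rewrite -rcons_cons size_rcons index_rcons_mem //; split => //.
      by rewrite (leq_trans lt1) // index_rcons_ge.
    by rewrite ltnW.
- by rewrite size_rcons; lia.
- by apply: next st' _; rewrite szp' size_rcons; lia.
Qed.
End PathPhase.

(** * Segments of the path as branch sets *)

Section Segments.
Variables (n K d q t : nat) (x0 : 'I_n).
Let L := d * K.

Lemma div_block a b : b < L -> (a * L + b) %/ L = a.
Proof.
by move=> bL; rewrite divnMDl ?divn_small ?addn0 //; apply: leq_ltn_trans bL.
Qed.

Lemma connected_segment (E : {set {set 'I_n}}) p (a : nat) :
  0 < L -> uniq (x0 :: p) -> path (graph_of_edges E) x0 p ->
  a.+1 * L <= (size p).+1 ->
  connected_on (graph_of_edges E)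
    [set x in x0 :: p | index x (x0 :: p) %/ L == a].
Proof.
set s := x0 :: p; set B := [set x in _ | _] => L0 us ps le_a.
have szs : size s = (size p).+1 by [].
have inB i : i < L -> nth x0 s (a * L + i) \in B.
  move=> iL; have lt : a * L + i < size s by rewrite szs; lia.
  by rewrite inE mem_nth // index_uniq // div_block // eqxx.
have outB x : x \in B -> exists2 i, i < L & x = nth x0 s (a * L + i).
  rewrite inE => /andP[xs /eqP xa]; exists (index x s %% L).
    by rewrite ltn_mod.
  by rewrite -{1}xa -divn_eq nth_index.
split; first by apply/set0Pn; exists (nth x0 s (a * L + 0)); apply: inB.
set e := [rel u v | _].
have esym : symmetric e.
  by move=> x y; rewrite /e /graph_of_edges /= andbCA [x == y]eq_sym setUC.
have step i j : i + j < L ->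
    connect e (nth x0 s (a * L + i)) (nth x0 s (a * L + (i + j))).
  elim: j => [|j IHj] ijL; first by rewrite addn0 connect0.
  apply: connect_trans (IHj _) _; first by lia.
  apply: connect1; rewrite /e /= !inB; [|lia..].
  have := pathP x0 ps (a * L + (i + j)); rewrite /= !addnS /=.
  by apply; lia.
move=> x y /outB[i iL ->] /outB[j jL ->].
have [le_ij|lt_ji] := leqP i j; first by rewrite -(subnKC le_ij) step // subnKC.
by rewrite (sym_connect_sym esym) -(subnKC (ltnW lt_ji)) step // subnKC // ltnW.
Qed.

Lemma waiter_forces_minor :
  0 < t -> q < K * d * d -> t * (d * K) + n %/ K + q + 1 <= n ->
  waiter_can_force (complete_edges n) q
    (fun E => has_complete_minor (graph_of_edges E) t).
Proof.
move=> t0 lt_q le_n; apply: waiter_can_force_of_forces.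
have K0 : 0 < K by case: K lt_q.
have d0 : 0 < d by case: d lt_q; rewrite ?muln0.
have L0 : 0 < L by rewrite muln_gt0 d0.
have tL0 : 0 < t * L by rewrite muln_gt0 t0.
(* The path has [t * L] vertices, [x0] included, hence one step fewer. *)
apply: (@path_phase n K q x0 _ (t * L).-1 [::]) => //.
- by split=> // e; rewrite /offered big_nil inE.
- by rewrite add0n; move: le_n; rewrite -/L; lia.
rewrite add0n => h p [us ps off] szp; set s := x0 :: p in us off.
have szs : size s = t * L by rewrite /= szp prednK.
pose v (a : 'I_t) i := nth x0 s (a * L + i).
have ltv (a : 'I_t) i : i < L -> a * L + i < size s.
  move=> iL; rewrite szs; have := ltn_ord a; nia.
have iv (a : 'I_t) i : i < L -> index (v a i) s = a * L + i.
  by move=> iL; rewrite /v index_uniq // ltv.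
(* The [d] offsets [c b (j, k)] are congruent modulo [K] to the number of the vertex [v b j]. As [K]
   divides [L], so are the positions [a * L + c b (j, k)], for every segment [a]. *)
pose c (b : 'I_t) (jk : 'I_L * 'I_d) := jk.2 * K + v b jk.1 %% K.
have ltc b jk : c b jk < L.
  apply: (@leq_trans (jk.2.+1 * K)); first by rewrite mulSnr ltn_add2l ltn_pmod.
  by rewrite leq_mul2r ltn_ord orbT.
pose f (ab : 'I_t * 'I_t) (jk : 'I_L * 'I_d) :=
  [set v ab.1 (c ab.2 jk); v ab.2 jk.1].
pose F ab := [set f ab jk | jk in [set: 'I_L * 'I_d]].
have vinj a b i j : i < L -> j < L -> v a i = v b j -> a = b /\ i = j.
  move=> iL jL /(congr1 (index^~ s)); rewrite !iv // => eq.
  have ab : nat_of_ord a = b by rewrite -(div_block a iL) eq div_block.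
  by split; [apply: val_inj | move: eq; rewrite ab; apply: addnI].
(* Positions determine the segments of both ends, and [a < b] tells the ends apart; [c] then gives
   back [k]. *)
have finj (ab ab' : 'I_t * 'I_t) jk jk' : ab.1 < ab.2 -> ab'.1 < ab'.2 ->
    f ab jk = f ab' jk' -> ab = ab' /\ jk = jk'.
  case: ab ab' jk jk' => [a b] [a' b'] [j k] [j' k'] /= lt lt'.
  move/set2_inj => -[] [/= /vinj eq1 /vinj eq2]; last first.
    have [ab' _] := eq1 (ltc _ _) (ltn_ord _).
    have [ba' _] := eq2 (ltn_ord _) (ltc _ _).
    by move: lt lt'; rewrite ab' ba'; lia.
  have [aa bb] := (eq1 (ltc _ _) (ltc _ _), eq2 (ltn_ord _) (ltn_ord _)).
  have [? ccE] := aa; have [? /ord_inj ?] := bb; subst a' b' j'.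
  move: ccE; rewrite /c /= => /addIn /eqP; rewrite eqn_pmul2r // => /eqP/ord_inj <-.
  by [].
pose l := [seq ab : 'I_t * 'I_t <- enum {: 'I_t * 'I_t} | ab.1 < ab.2].
have ltl ab : ab \in l -> ab.1 < ab.2 by rewrite mem_filter => /andP[].
apply: (@forces_transversal _ _ _ _ F l).
- by rewrite filter_uniq // enum_uniq.
- move=> ab /ltl lt; rewrite card_in_imset; last first.
    by move=> jk jk' _ _ eq; have [] := finj _ _ _ _ lt lt eq.
  by rewrite cardsT card_prod !card_ord /L (mulnC d).
- move=> [a b] /ltl /= lt; apply/subsetP => e /imsetP[[j k] _ ->].
  have ne : v a (c b (j, k)) != v b j.
    by apply/eqP => /vinj [] // eq; rewrite eq ltnn in lt.
  (* An edge offered during the path phase avoids the residue class of its first end's position,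
     while [c] was chosen inside that class. *)
  rewrite !inE cards2 /= ne andbT; apply/negP => /off[x [u [eq lt1 _ uK]]].
  have lt2 : index (v a (c b (j, k))) s < index (v b j) s.
    by rewrite !iv //; have := ltc b (j, k); nia.
  case: (set2_inj eq) => -[xe ue].
    have : v b j %% K != index (v a (c b (j, k))) s %% K by rewrite xe ue.
    rewrite iv // /L mulnA modnMDl /c /= modnMDl.
    by rewrite modn_mod eqxx.
  by move: lt2; rewrite xe ue ltnNge (ltnW lt1).
- move=> ab ab' /ltl lt /ltl lt' ne; apply/pred0P => e /=.
  apply/negP=> /andP[/imsetP[jk _ ->] /imsetP[jk' _ /finj[]]] //.
  by move=> eq; rewrite eq eqxx in ne.
move=> C sC meets.
exists (fun a : 'I_t => [set x in s | index x s %/ L == a]); split=> [a|a b lt_ab].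
  apply: connected_segment => //; last first.
    by move: szs => /= ->; rewrite leq_mul2r ltn_ord orbT.
  apply: sub_path ps => x y /andP[xy exy].
  by rewrite /graph_of_edges /= xy (subsetP sC).
split.
  apply/pred0P => x /=; rewrite !inE; apply/negP => /andP[/andP[_ /eqP xa]].
  by case/andP=> _; rewrite xa; move: lt_ab; case: ltngtP.
have [|e] := meets (a, b); first by rewrite mem_filter lt_ab mem_enum.
case/imsetP=> [[j k]] _ -> jkC.
have vB (a' : 'I_t) i : i < L -> v a' i \in [set x in s | index x s %/ L == a'].
  by move=> iL; rewrite inE mem_nth ?ltv // iv // div_block // eqxx.
exists (v a (c b (j, k))), (v b j); rewrite !vB //; split=> //.
apply/andP; split; last exact: jkC.
by apply/eqP => /vinj [] // eq; rewrite eq ltnn in lt_ab.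
Qed.

End Segments.

(** * Client's potential *)

Section Potential.
Local Open Scope ring_scope.
Variables (R : realFieldType) (T : finType) (X : {set T}) (q : nat).
Variables (I : finType) (Q : pred I) (A : I -> {set T}).
Implicit Types (C O B : {set T}).

Let w : R := q.+1%:R^-1.

(** The weight of [A i] once [O] has been offered and Client holds [C]: zero if Waiter owns an
    element of [A i], otherwise a factor [1 / (q + 1)] for each element not yet offered. *)
Definition danger C O i : R :=
  if A i :&: O \subset C then w ^+ #|A i :\: O| else 0.

Definition potential C O : R := \sum_(i | Q i) danger C O i.

Lemma danger_ge0 C O i : 0 <= danger C O i.
Proof. by rewrite /danger; case: ifP => // _; rewrite exprn_ge0 // invr_ge0. Qed.

(** If [A i] misses [B], no answer changes its weight. If it meets [B] in one element, only that
    answer keeps it alive, with weight multiplied by [q + 1]. If it meets [B] twice, every answer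
    kills it. *)
Lemma sum_danger_le C O B i : C \subset O -> [disjoint B & O] -> #|B| = q.+1 ->
  \sum_(c in B) danger (c |: C) (B :|: O) i <= danger C O i *+ q.+1.
Proof.
move=> sCO dBO cB.
have BO x : x \in B -> x \notin O by move/(disjointFr dBO)->.
have BC x : x \in B -> x \notin C.
  by move=> /BO; apply: contra; apply: (subsetP sCO).
have surv c : c \in B -> A i :&: (B :|: O) \subset c |: C ->
    A i :&: O \subset C /\ A i :&: B \subset [set c].
  move=> cB' /subsetP sub; split; apply/subsetP => x; rewrite in_setI.
    case/andP=> xA xO; have := sub x.
    rewrite !inE xA xO orbT => /(_ isT) /predU1P[xc|//].
    by move: (BO c cB'); rewrite -xc xO.
  case/andP=> xA xO; have := sub x.
  rewrite !inE xA xO /= => /(_ isT) /predU1P[->|xC].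
    by rewrite eqxx.
  by move: (BC x xO); rewrite xC.
have [sO|nsO] := boolP (A i :&: O \subset C); last first.
  rewrite big1 ?mulrn_wge0 ?danger_ge0 // => c cB'.
  rewrite /danger; case: ifP => // /(surv c cB')[sO _].
  by rewrite sO in nsO.
rewrite {2}/danger sO.
have [AB0|[a]] := set_0Vmem (A i :&: B).
  rewrite (eq_bigr (fun=> w ^+ #|A i :\: O|)) ?sumr_const ?cB // => c cB'.
  rewrite /danger setIUr AB0 set0U (subset_trans sO) ?subsetUr //.
  congr (_ ^+ #|pred_of_set _|); apply/setP => x; rewrite !inE negb_or.
  move/setP: AB0 => /(_ x); rewrite !inE.
  by case: (x \in A i); rewrite ?andbF //= => ->.
rewrite in_setI => /andP[aA aB].
rewrite (bigD1 a) //= [X in _ + X]big1 ?addr0 => [|c /andP[cB' ca]]; last first.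
  rewrite /danger; case: ifP => // /(surv c cB')[_ /subsetP/(_ a)].
  by rewrite !inE aA aB eq_sym (negPf ca) => /(_ isT).
rewrite /danger; case: ifP => [/(surv a aB)[_ AB]|_]; last first.
  by rewrite mulrn_wge0 // exprn_ge0 // invr_ge0.
have -> : A i :\: O = a |: (A i :\: (B :|: O)).
  apply/setP => x; rewrite !inE negb_or.
  have [->|xa] /= := eqVneq x a; first by rewrite aA BO.
  have [xA|] := boolP (x \in A i); rewrite ?andbF // !andbT.
  suff -> : x \notin B by [].
  apply/negP => xB; have := subsetP AB x; rewrite !inE xA xB => /(_ isT).
  by rewrite (negPf xa).
have w1 : w *+ q.+1 = 1 by rewrite -mulr_natr mulVf // pnatr_eq0.
by rewrite cardsU1 !inE aB /= exprS -mulrnAl w1 mul1r.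
Qed.

Lemma potential_claim C O B : C \subset O -> [disjoint B & O] -> #|B| = q.+1 ->
  exists2 c, c \in B & potential (c |: C) (B :|: O) <= potential C O.
Proof.
move=> sCO dBO cB; apply: contrapT => none.
have lt c : c \in B -> potential C O < potential (c |: C) (B :|: O).
  by move=> cB'; rewrite ltNge; apply/negP => le; apply: none; exists c.
have: \sum_(c in B) potential (c |: C) (B :|: O) <= potential C O *+ q.+1.
  rewrite exchange_big -sumrMnl /=; apply: ler_sum => i _.
  exact: sum_danger_le.
apply/negP; rewrite -ltNge -cB -sumr_const.
have [c0 c0B] : exists c, c \in B by apply/set0Pn; rewrite -card_gt0 cB.
rewrite (bigD1 c0) //= [X in _ < X](bigD1 c0) //= ltr_leD ?lt //.
by apply: ler_sum => c /andP[/lt/ltW].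
Qed.

(** Averaging over the offer gives an answer that does not raise the potential. It starts below 1,
    whereas a fully claimed [A i] alone contributes 1. *)
Lemma client_avoids :
  \sum_(i | Q i) w ^+ #|A i| < 1 ->
  client_can_maintain X q (fun E => forall i, Q i -> ~ A i \subset E).
Proof.
move=> lt1.
pose Ph h := potential (client_claimed h) (offered h).
pose better h B c :=
  potential (c |: client_claimed h) (B :|: offered h) <= Ph h.
pose S (h : history T) B : {set T} :=
  if #|B| == q.+1 then
    if [pick c in B | better h B c] is Some c then [set c] else set0
  else set0.
have offer_disj h B : legal_offer X q h B -> [disjoint B & offered h].
  by case/andP=> sB _; move: sB; rewrite /free_elts subsetD => /andP[].
have S_full h B : client_claimed h \subset offered h -> legal_offer X q h B ->
    #|B| = q.+1 -> exists c, [/\ S h B = [set c], c \in B & better h B c].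
  move=> sCO lB cB; rewrite /S cB eqxx; case: pickP => [c /andP[cB' bc]|none].
    by exists c.
  have [c cB' bc] := potential_claim sCO (offer_disj _ _ lB) cB.
  by have := none c; rewrite /= cB' /better bc.
have S_sub h B : S h B \subset B.
  rewrite /S; case: ifP; rewrite ?sub0set // => _.
  by case: pickP => [c /andP[cB _]|_]; rewrite ?sub1set ?sub0set.
have inv h : client_play X q S h ->
    client_claimed h \subset offered h /\ Ph h < 1.
  elim=> {h} [|h B _ [sCO lt] nover lB].
    rewrite /Ph /client_claimed /offered !big_nil; split=> //.
    apply: le_lt_trans lt1; apply: ler_sum => i _.
    by rewrite /danger setI0 sub0set setD0.
  rewrite /Ph client_claimed_cons offered_cons; split; first exact: setUSS.
  have [cB|ncB] := eqVneq #|B| q.+1.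
    have [c [-> _ bc]] := S_full h B sCO lB cB; exact: le_lt_trans bc lt.
  (* In a short final round Client claims nothing, so a set still alive has no newly offered element
     and keeps its weight. *)
  rewrite {1}/S (negPf ncB) set0U; apply: le_lt_trans lt; apply: ler_sum => i _.
  rewrite /danger; case: ifP => [sAC|_]; last exact: danger_ge0.
  rewrite (subset_trans _ sAC) ?setIS ?subsetUr //.
  suff -> : A i :\: (B :|: offered h) = A i :\: offered h by [].
  apply/setP => x; rewrite !inE negb_or.
  have [xB|//] := boolP (x \in B); rewrite /=.
  have [xA|] := boolP (x \in A i); rewrite ?andbF // andbT.
  have := subsetP sAC x; rewrite !inE xA xB => /(_ isT) /(subsetP sCO) ->.
  by [].
exists S; split=> [h B /inv[sCO _] _ lB|h /inv[sCO lt] i Qi sA].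
  rewrite /legal_claim S_sub /=.
  have [cB|ncB] := eqVneq #|B| q.+1.
    by have [c [-> _ _]] := S_full h B sCO lB cB; rewrite cards1 cB subSnn.
  rewrite /S (negPf ncB) cards0; move/andP: lB => [_ /eqP cB].
  by move: ncB; rewrite cB; lia.
move: lt; apply/negP; rewrite -leNgt /Ph /potential (bigD1 i) //=.
have sAO := subset_trans sA sCO.
rewrite {1}/danger (setIidPl sAO) sA.
have -> : A i :\: offered h = set0 by apply/eqP; rewrite setD_eq0.
by rewrite cards0 expr0 lerDl sumr_ge0 // => j _; apply: danger_ge0.
Qed.

End Potential.

(** * Dense sets and chords *)

(* Positions joined by an edge: the consecutive ones on a path with [k]
   vertices, and a chord at each end. *)
Definition chord_pairs k i j : seq (nat * nat) :=
  [:: (0, j), (i, k.-1) & [seq (a, a.+1) | a <- iota 0 k.-1]].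

Section EdgeCount.
Variables (V : finType) (e : rel V).
Hypotheses (esym : symmetric e) (eirr : irreflexive e).
Implicit Types S W : {set V}.

(* [edges_between W W] counts every edge inside [W] twice. *)
Definition edges_between S W := \sum_(x in S) \sum_(y in W) (e x y : nat).

Lemma edges_betweenC S W : edges_between S W = edges_between W S.
Proof.
rewrite /edges_between exchange_big; apply: eq_bigr => y _.
by apply: eq_bigr => x _; rewrite esym.
Qed.

Lemma edges_betweenUl S S' W : [disjoint S & S'] ->
  edges_between (S :|: S') W = edges_between S W + edges_between S' W.
Proof.
move=> d; rewrite /edges_between -bigU //; apply: eq_bigl => x.
by rewrite !inE.
Qed.

Lemma edges_betweenUr S W W' : [disjoint W & W'] ->
  edges_between S (W :|: W') = edges_between S W + edges_between S W'.
Proof. by move=> d; rewrite ![edges_between S _]edges_betweenC edges_betweenUl. Qed.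

Lemma edges_betweenU S W : [disjoint S & W] ->
  edges_between (S :|: W) (S :|: W) =
  edges_between S S + edges_between W W + (edges_between S W).*2.
Proof.
move=> d; rewrite edges_betweenUl // !edges_betweenUr //.
by rewrite (edges_betweenC W S); lia.
Qed.

Lemma edges_between_gt0 S W x y :
  x \in S -> y \in W -> e x y -> 0 < edges_between S W.
Proof.
move=> xS yW exy; rewrite /edges_between (bigD1 x) //= (bigD1 y) //= exy.
by rewrite -addnA.
Qed.

(** A spanning tree is grown vertex by vertex along edges leaving the part already reached; each
    adds 2 to the double count. *)
Lemma connected_edge_count S :
  connected_on e S -> #|S|.*2 <= edges_between S S + 2.
Proof.
case=> /set0Pn[x0 x0S] conn.
suff grow k : k < #|S| -> exists W : {set V},
    [/\ W \subset S, x0 \in W, #|W| = k.+1 & k.*2 <= edges_between W W].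
  have S0 : 0 < #|S| by apply/card_gt0P; exists x0.
  have [|W [sW _ cW le]] := grow #|S|.-1; first by lia.
  have /eqP WS : W == S by rewrite eqEcard sW; lia.
  by move: le; rewrite WS; lia.
elim: k => [|k IHk] ltk.
  by exists [set x0]; rewrite sub1set x0S set11 cards1.
have [|W [sW x0W cW le]] := IHk; first exact: ltnW.
have [u [v [uW vS vW euv]]] : exists u v, [/\ u \in W, v \in S, v \notin W & e u v].
  apply: contrapT => none.
  have /subsetPn[y yS yW] : ~~ (S \subset W).
    by apply/negP => /subset_leq_card; lia.
  have /connectP[p] := conn _ _ x0S yS.
  move: x0W; generalize x0 as x; elim: p => /= [|z p IHp] x xW.
    by move=> _ yx; rewrite yx xW in yW.
  case/andP=> /and3P[_ zS exz] pz yl; apply: (IHp z) => //.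
  apply: contrapT => /negP zW; apply: none; by exists x, z.
exists (W :|: [set v]).
have dWv : [disjoint W & [set v]] by rewrite disjoint_sym disjoints1.
split.
- by rewrite subUset sW sub1set.
- by rewrite inE x0W.
- by rewrite setUC cardsU1 vW cW.
rewrite edges_betweenU //.
have := edges_between_gt0 uW (set11 v) euv; lia.
Qed.

(** Take the union of the branch sets: four trees give [#|W| - 4] edges, and the six pairs of branch
    sets give at least six more. *)
Lemma K4_minor_edge_count : has_complete_minor e 4 ->
  exists W : {set V}, #|W|.*2 < edges_between W W.
Proof.
case=> B [conn sep].
pose i0 : 'I_4 := @Ordinal 4 0 isT; pose i1 : 'I_4 := @Ordinal 4 1 isT.
pose i2 : 'I_4 := @Ordinal 4 2 isT; pose i3 : 'I_4 := @Ordinal 4 3 isT.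
have pos (i j : 'I_4) : i < j -> 0 < edges_between (B i) (B j).
  by move=> /sep[_ [x [y [xB yB exy]]]]; apply: edges_between_gt0 exy.
have dis (i j : 'I_4) : i < j -> [disjoint B i & B j] by move=> /sep[].
have dU (S S' W : {set V}) : [disjoint S & W] -> [disjoint S' & W] ->
    [disjoint S :|: S' & W].
  by rewrite -!setI_eq0 setIUl setU_eq0 => -> ->.
have d2 : [disjoint B i0 :|: B i1 & B i2] by rewrite dU ?dis.
have d3 : [disjoint B i0 :|: B i1 :|: B i2 & B i3] by rewrite !dU ?dis.
exists (B i0 :|: B i1 :|: B i2 :|: B i3).
have cU (S W : {set V}) : [disjoint S & W] -> #|S :|: W| = #|S| + #|W|.
  by move=> d; rewrite cardsU disjoint_setI0 // cards0 subn0.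
rewrite edges_betweenU // edges_betweenU // edges_betweenU ?dis //.
rewrite !edges_betweenUl ?dis // !cU ?dis //.
have := connected_edge_count (conn i0); have := connected_edge_count (conn i1).
have := connected_edge_count (conn i2); have := connected_edge_count (conn i3).
have := pos i0 i1 isT; have := pos i0 i2 isT; have := pos i0 i3 isT.
have := pos i1 i2 isT; have := pos i1 i3 isT; have := pos i2 i3 isT.
lia.
Qed.

Lemma edges_between1 x W : edges_between [set x] W = #|[set y in W | e x y]|.
Proof.
rewrite /edges_between big_set1 -sum1dep_card big_mkcondr.
by apply: eq_bigr => y _; case: (e x y).
Qed.

(** * Longest paths in a set of minimum degree two *)

Section Dense.
Variable W : {set V}.
Hypothesis deg2 : forall x, x \in W -> 1 < #|[set y in W | e x y]|.
Hypothesis no_chords : forall x0 s i j,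
  uniq s -> uniq (chord_pairs (size s) i j) ->
  (forall ab, ab \in chord_pairs (size s) i j ->
     [/\ ab.1 < ab.2, ab.2 < size s & e (nth x0 s ab.1) (nth x0 s ab.2)]) -> False.

Definition path_in x p :=
  [/\ uniq (x :: p), path e x p & {subset x :: p <= W}].

Lemma other_neighbour x z : x \in W ->
  exists y, [/\ y \in W, e x y & y != z].
Proof.
move=> /deg2 deg; apply: contrapT => none.
suff : #|[set y in W | e x y]| <= #|[set z]| by rewrite cards1; lia.
apply: subset_leq_card; apply/subsetP => y; rewrite !inE => /andP[yW exy].
by apply/negPn/negP => yz; apply: none; exists y.
Qed.

(** By maximality, all neighbours in [W] of either end lie on the path. Each end has a neighbour
    other than its path neighbour, and without two distinct chords both of these must be the edge
    joining the ends. *)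
Lemma longest_path_end x p : path_in x p ->
  (forall y p', path_in y p' -> size p' <= size p) ->
  exists z, [/\ e x (last x p), z \in p, last x p \in p &
    forall y, y \in W -> e x y -> y = z \/ y = last x p].
Proof.
move=> [us ps sW] maxp.
have xW : x \in W by apply: sW; rewrite mem_head.
pose l := last x p; have lW : l \in W by apply: sW; rewrite mem_last.
have nbx y : y \in W -> e x y -> y \in p.
  move=> yW exy; apply: contrapT => /negP yp.
  suff : path_in y (x :: p) by move/maxp => /=; lia.
  split.
    rewrite cons_uniq us inE negb_or yp !andbT.
    by apply: contraTneq exy => ->; rewrite eirr.
    by rewrite /= esym exy.
  by move=> u; rewrite inE => /predU1P[->|/sW].
have nbl y : y \in W -> e l y -> y \in x :: p.
  move=> yW ely; apply: contrapT => /negP yp.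
  suff : path_in x (rcons p y) by move/maxp; rewrite size_rcons; lia.
  split; first by rewrite -rcons_cons rcons_uniq yp.
    by rewrite rcons_path ps.
  by move=> u; rewrite -rcons_cons mem_rcons inE => /predU1P[->|/sW].
pose s := x :: p; pose k := size p.
have [y1 [y1W exy1 _]] := other_neighbour x xW.
have k0 : 0 < k by have := nbx _ y1W exy1; rewrite /k; case: (p).
have il : index l s = k by rewrite /l index_last.
pose z := nth x s 1; pose z' := nth x s k.-1.
have iz' : index z' s = k.-1 by rewrite index_uniq //= ltnS leq_pred.
(* A chord at [x] and a chord at [l] are the same edge, since otherwise their positions contradict
   [no_chords]. *)
have key y y' : y \in W -> e x y -> y != z -> y' \in W -> e l y' -> y' != z' ->
    y = l /\ y' = x.
  move=> yW exy yz y'W ely' y'z'.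
  have ys : y \in s by rewrite inE nbx ?orbT.
  have y's : y' \in s := nbl _ y'W ely'.
  have jk : index y s < k.+1 by rewrite -[k.+1]/(size s) index_mem.
  have ik : index y' s < k.+1 by rewrite -[k.+1]/(size s) index_mem.
  have y0 : index y s != 0.
    apply/eqP => i0; move: exy; rewrite -(nth_index x ys) i0 /= eirr.
    by [].
  have y1' : index y s != 1.
    by apply: contraNneq yz => i1; rewrite -(nth_index x ys) i1.
  have yk : index y' s != k.
    apply/eqP => i0; move: ely'; rewrite -(nth_index x y's) i0 -il nth_index ?mem_last //.
    by rewrite eirr.
  have yk1 : index y' s != k.-1.
    by apply: contraNneq y'z' => i1; rewrite -(nth_index x y's) i1.
  have [[iy iy']|ne] := pselect (index y s = k /\ index y' s = 0).
    by rewrite -(nth_index x ys) -(nth_index x y's) iy iy' /= -il nth_index ?mem_last.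
  have yj := nth_index x ys; have y'i := nth_index x y's.
  move: (index y s) (index y' s) yj y'i jk ik y0 y1' yk yk1 ne.
  move=> j i yj y'i jk ik y0 y1' yk yk1 ne.
  case: (@no_chords x s i j) => //.
    rewrite /chord_pairs [size s]/= -/k cons_uniq cons_uniq in_cons negb_or.
    rewrite map_inj_uniq ?iota_uniq; last by move=> ? ? [].
    rewrite andbT -andbA; apply/and3P; split.
    - by apply/negP => /eqP[i0 i1]; apply: ne.
    - by apply/mapP => -[a _ [a0 ja]]; move: y1'; rewrite ja -a0.
    - by apply/mapP => -[a _ [ia ak]]; move: yk1; rewrite /= ak ia eqxx.
  rewrite /chord_pairs [size s]/= -/k => -[a b].
  rewrite !in_cons => /or3P[|| /mapP[c]].
  - case/eqP=> -> ->; split; [by rewrite lt0n|exact: jk|].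
    by rewrite yj.
  - case/eqP=> -> ->; split; [|exact: ltnSn|].
      by rewrite [X in X < _]/= [X in _ < X]/=; move: ik yk yk1; clear; lia.
    by rewrite esym y'i -[k in nth x s k]il nth_index ?mem_last.
  - rewrite mem_iota /= => ck [-> ->]; split=> //=.
    by have /pathP := ps => /(_ x c); rewrite add0n in ck; apply.
have [y [yW exy yz]] := other_neighbour z xW.
have [y' [y'W ely' y'z']] := other_neighbour z' lW.
have [yl y'x] := key _ _ yW exy yz y'W ely' y'z'.
have exl : e x l by rewrite -yl.
exists z; split=> //; first by rewrite /z /= mem_nth.
  exact: nbx.
move=> u uW exu; have [->|uz] := eqVneq u z; [by left|right].
by have [] := key _ _ uW exu uz y'W ely' y'z'.
Qed.

(** A longest path closes to a cycle, and cutting that cycle open at any vertex gives another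
    longest path. So every vertex of the cycle has at most two neighbours in [W], all on the
    cycle. *)
Lemma closed_cycle_component : W != set0 -> exists S : {set V},
  [/\ S != set0, S \subset W, edges_between S (W :\: S) = 0 &
      edges_between S W <= #|S|.*2].
Proof.
case/set0Pn=> w wW.
pose Pk k := `[< exists x p, path_in x p /\ size p = k >].
have exP : exists k, Pk k.
  exists 0; apply/asboolP; exists w, [::]; split=> //; split=> //.
  by move=> u; rewrite inE => /eqP->.
have bndP k : Pk k -> k <= #|V|.
  move/asboolP=> [x [p [[/card_uniqP /= c _ _] <-]]].
  by have := max_card (mem (x :: p)); rewrite c => /ltnW.
case: (ex_maxnP exP bndP) => k /asboolP[x [p [px szp]]] maxk.
have maxp (q : seq V) : forall y p', path_in y p' ->
    size q = size p -> size p' <= size q.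
  by move=> y p' py ->; rewrite szp maxk //; apply/asboolP; exists y, p'.
have ends y q : path_in y q -> size q = size p -> _ :=
  fun py sz => longest_path_end py (fun y' p' py' => maxp q y' p' py' sz).
have [z [exl _ _ _]] := ends x p px erefl.
have [us ps sW] := px.
have cyc : cycle e (x :: p) by rewrite /= rcons_path ps esym.
have nbr y : y \in x :: p -> exists z z', [/\ z \in x :: p, z' \in x :: p &
    forall u, u \in W -> e y u -> u = z \/ u = z'].
  move=> ys; have [i q eqr] := rot_to ys.
  have memr u : (u \in y :: q) = (u \in x :: p) by rewrite -eqr mem_rot.
  have py : path_in y q.
    split; first by rewrite -eqr rot_uniq.
      have : cycle e (y :: q) by rewrite -eqr rot_cycle.
      by rewrite /= rcons_path => /andP[].
    by move=> u; rewrite memr => /sW.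
  have szq : size q = size p.
    by have := congr1 size eqr; rewrite size_rot /= => -[].
  have [z1 [_ z1q lq nb]] := ends y q py szq.
  by exists z1, (last y q); rewrite -!memr !inE z1q lq !orbT.
exists [set u in x :: p]; set S := [set u in _].
have memS u : (u \in S) = (u \in x :: p) by rewrite in_set.
split.
- by apply/set0Pn; exists x; rewrite memS mem_head.
- by apply/subsetP => u; rewrite memS; apply: sW.
- rewrite /edges_between big1 // => y; rewrite memS => /nbr[z1 [z2 [m1 m2 nb]]].
  rewrite big1 // => u; rewrite in_setD memS => /andP[uS uW].
  apply/eqP; rewrite eqb0; apply/negP => /(nb _ uW)[] eu.
    by rewrite eu m1 in uS.
  by rewrite eu m2 in uS.
- rewrite -mul2n mulnC -sum_nat_const; apply: leq_sum => y.
  rewrite memS => /nbr[z1 [z2 [_ _ nb]]].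
  have -> : \sum_(u in W) (e y u : nat) = #|[set u in W | e y u]|.
    by rewrite -edges_between1 /edges_between big_set1.
  apply: leq_trans (_ : #|[set z1; z2]| <= 2); last by rewrite cards2; case: (_ != _).
  apply: subset_leq_card; apply/subsetP => u; rewrite in_set in_set2 => /andP[uW eyu].
  by case: (nb u uW eyu) => ->; rewrite eqxx ?orbT.
Qed.

End Dense.

(** Induction on [#|W|]: without chords, deleting a nonempty part of [W] must leave a set that is no
    longer dense. Deleting the cycle component contradicts this, as it removes at most as many edges
    as vertices. *)
Lemma dense_has_chords (W : {set V}) : #|W|.*2 < edges_between W W ->
  exists x0 s i j, [/\ uniq s, uniq (chord_pairs (size s) i j) &
  forall ab, ab \in chord_pairs (size s) i j ->
     [/\ ab.1 < ab.2, ab.2 < size s & e (nth x0 s ab.1) (nth x0 s ab.2)]].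
Proof.
move=> dW; apply: contrapT => none.
have [m] := ubnP #|W|; elim: m W dW => // m IHm W dW cW.
have small S : S \subset W -> S != set0 -> 
   edges_between (W :\: S) (W :\: S) <= #|W :\: S|.*2.
  move=> sSW S0; rewrite leqNgt; apply/negP => /IHm; apply.
  rewrite cardsD (setIidPr sSW); have := subset_leq_card sSW.
  by move: S0; rewrite -card_gt0; lia.
have split S : S \subset W -> edges_between W W =
    edges_between S S + edges_between (W :\: S) (W :\: S) +
    (edges_between S (W :\: S)).*2 /\ #|W| = #|S| + #|W :\: S| /\
    edges_between S W = edges_between S S + edges_between S (W :\: S).
  move=> sSW; have dS : [disjoint S & W :\: S].
    by apply/pred0P => x /=; rewrite in_setD; case: (x \in S).
  rewrite -edges_betweenU // -edges_betweenUr //.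
  rewrite -[S in S :|: _](setIidPr sSW) setID; do ?split=> //.
  by rewrite -(cardsID S W) (setIidPr sSW).
(* Deleting [x] takes twice its degree off the double count and 2 off [#|W|.*2]; density is lost, so
   the degree exceeds 1. *)
have deg2 x : x \in W -> 1 < #|[set y in W | e x y]|.
  move=> xW; rewrite -edges_between1.
  have sx : [set x] \subset W by rewrite sub1set.
  have x0 : [set x] != set0 by apply/set0Pn; exists x; rewrite set11.
  have [eW [cWE ->]] := split _ sx; have := small _ sx x0.
  have xx0 : edges_between [set x] [set x] = 0.
    by rewrite /edges_between !big_set1 eirr.
  by move: dW; rewrite eW cWE xx0 cards1; lia.
have W0 : W != set0.
  by apply: contraTneq dW => ->; rewrite /edges_between big_set0 cards0.
have [|S [S0 sSW eS dS]] := @closed_cycle_component W deg2 _ W0.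
  by move=> x0 s i j us uc ch; apply: none; exists x0, s, i, j.
have [eW [cWE eSW]] := split _ sSW; have := small _ sSW S0.
move: dW dS; rewrite eW cWE eSW eS; lia.
Qed.

End EdgeCount.

(** * Summing over chord configurations *)

Section ChordEdges.
Variables (V : finType) (x0 : V) (s : seq V).

Definition chord_edges i j : {set {set V}} :=
  [set:: [seq [set nth x0 s ab.1; nth x0 s ab.2] | ab <- chord_pairs (size s) i j]].

(** There are [size s - 1] path edges and two chords; all pairs are increasing, so distinct pairs
    give distinct unordered edges. *)
Lemma card_chord_edges i j : 0 < size s -> uniq s ->
  uniq (chord_pairs (size s) i j) ->
  (forall ab, ab \in chord_pairs (size s) i j -> ab.1 < ab.2 < size s) ->
  #|chord_edges i j| = (size s).+1.
Proof.
move=> s0 us uc lt; rewrite /chord_edges cardsE (card_uniqP _).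
  by rewrite size_map /= size_map size_iota; lia.
rewrite map_inj_in_uniq // => -[a b] [a' b'] /lt /= /andP[ab bs] /lt /=.
case/andP=> ab' bs'; have as_ := ltn_trans ab bs; have as' := ltn_trans ab' bs'.
case/set2_inj=> -[] /eqP + /eqP; rewrite !nth_uniq // => /eqP E1 /eqP E2.
  by rewrite E1 E2.
by move: ab ab'; rewrite E1 E2 => /ltnW; rewrite leqNgt => /negP.
Qed.

End ChordEdges.

Local Open Scope ring_scope.

Section Sum.
Variable R : realFieldType.

(* The right-hand side minus the sum telescopes: it equals
   [(N^2 / d + 2 N / d^2 + (2 + d) / d^3) / (1 + d)^N]. *)
Lemma sum_sq_geometric (d : R) N : 0 < d ->
  \sum_(k < N) k%:R ^+ 2 / (1 + d) ^+ k.+1 <= (2 + d) / d ^+ 3.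
Proof.
move=> d0; have d1 : 0 < 1 + d by lra.
suff eq : \sum_(k < N) k%:R ^+ 2 / (1 + d) ^+ k.+1 = (2 + d) / d ^+ 3 -
    (N%:R ^+ 2 / d + 2 * N%:R / d ^+ 2 + (2 + d) / d ^+ 3) / (1 + d) ^+ N.
  rewrite eq lerBlDr lerDl; apply: divr_ge0; last by rewrite exprn_ge0 // ltW.
  have [dle d2 d3] : [/\ 0 <= d, 0 <= d ^+ 2 & 0 <= d ^+ 3].
    by rewrite !exprn_ge0 // ltW.
  by rewrite !addr_ge0 // ?divr_ge0 ?mulr_ge0 ?addr_ge0 ?sqr_ge0 ?ler0n.
elim: N => [|N IHN].
  by rewrite big_ord0 expr0 expr0n /= mulr0 !mul0r !add0r divr1 subrr.
rewrite big_ord_recr /= IHN -(natr1 N) ![(1 + d) ^+ N.+1]exprS.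
have : (1 + d) ^+ N != 0 by rewrite expf_neq0 // gt_eqF.
move: ((1 + d) ^+ N) (N%:R : R) => y m y0; field.
by rewrite y0 !gt_eqF.
Qed.

(** Configurations on [k] vertices contribute at most [n ^ k * k ^ 2 / (n * (1 + d)) ^ (k + 1)], and
    summing over [k] gives at most [(2 + d) / (n * d ^ 3) < 1]. *)
Lemma client_avoids_K4 n q (x0 : 'I_n) (d : R) : 0 < d ->
  n%:R * (1 + d) <= q.+1%:R -> 2 + d < n%:R * d ^+ 3 ->
  client_can_maintain (complete_edges n) q
    (fun E => ~ has_complete_minor (graph_of_edges E) 4).
Proof.
move=> d0 le_q lt_d.
have n0 : 0 < n%:R :> R by rewrite ltr0n; case: n x0 {le_q lt_d} => // -[].
(* The vertex sequence and the inner ends of the two chords; [J 0] is empty, because ['I_0] is. *)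
pose J (k : 'I_n.+1) : finType := (k.-tuple 'I_n * ('I_k * 'I_k))%type.
pose I := {k : 'I_n.+1 & J k}.
pose ch (i : I) := chord_pairs (tag i) (tagged i).2.1 (tagged i).2.2.
pose Q (i : I) := [&& uniq (tagged i).1, uniq (ch i) &
  all (fun ab : nat * nat => (ab.1 < ab.2 < tag i)%N) (ch i)].
pose A (i : I) := chord_edges x0 (tagged i).1 (tagged i).2.1 (tagged i).2.2.
pose w : R := q.+1%:R^-1.
have w0 : 0 < w by rewrite invr_gt0.
have [|S [legal avoid]] := @client_avoids R _ (complete_edges n) q I Q A.
  rewrite -/w.
  apply: (@le_lt_trans _ _ (\sum_(i : I) w ^+ (tag i).+1)).
    rewrite big_mkcond; apply: ler_sum => -[k [s [a b]]] _.
    case: ifP => [/and3P[us uc /allP lt]|_]; last by rewrite exprn_ge0 ?ltW.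
    rewrite /A card_chord_edges ?size_tuple //.
    exact: leq_ltn_trans (ltn_ord a).
  rewrite -(sig_big_dep xpredT (fun k : 'I_n.+1 => (xpredT : pred (J k)))
    (fun (k : 'I_n.+1) (_ : J k) => w ^+ k.+1)) /=.
  apply: (@le_lt_trans _ _ (\sum_(k < n.+1) k%:R ^+ 2 / (1 + d) ^+ k.+1 / n%:R)).
    apply: ler_sum => k _; rewrite sumr_const card_prod card_prod card_tuple !card_ord.
    have -> : k%:R ^+ 2 / (1 + d) ^+ k.+1 / n%:R =
        (n%:R * (1 + d))^-1 ^+ k.+1 *+ (n ^ k * (k * k)) :> R.
      rewrite -[RHS]mulr_natr !natrM natrX invfM exprMn !exprVn [n%:R ^+ k.+1]exprS.
      have : n%:R ^+ k != 0 :> R by rewrite expf_neq0 // gt_eqF.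
      have : (1 + d) ^+ k.+1 != 0 by rewrite expf_neq0 // gt_eqF //; lra.
      move: ((1 + d) ^+ k.+1) (n%:R ^+ k : R) => y m y0 m0; field.
      by rewrite y0 m0 gt_eqF.
    have ny0 : 0 < n%:R * (1 + d) by rewrite mulr_gt0 //; lra.
    rewrite lerMn2r; apply/orP; right.
    have le_w : w <= (n%:R * (1 + d))^-1 by rewrite lef_pV2 ?posrE.
    by apply: lerXn2r; rewrite // nnegrE ltW // invr_gt0.
  rewrite -mulr_suml ltr_pdivrMr // mul1r (le_lt_trans (sum_sq_geometric _ d0)) //.
  by rewrite ltr_pdivrMr ?exprn_gt0.
exists S; split=> // h hS minor; have esym := @graph_of_edges_sym _ (client_claimed h).
have eirr : irreflexive (graph_of_edges (client_claimed h)).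
  by move=> x; rewrite /graph_of_edges /= eqxx.
have [W dW] := K4_minor_edge_count esym minor.
have [y0 [s [i [j [us uc ch_e]]]]] := dense_has_chords esym eirr dW.
have szn : (size s < n.+1)%N.
  by rewrite ltnS -(card_uniqP us) -[X in (_ <= X)%N]card_ord max_card.
have /ch_e[_ js _] : (0%N, j) \in chord_pairs (size s) i j by rewrite !inE eqxx.
have /ch_e[ik ks _] : (i, (size s).-1) \in chord_pairs (size s) i j.
  by rewrite !inE eqxx orbT.
have is_ : (i < size s)%N by apply: ltn_trans ik ks.
pose idx : I := @Tagged _ (Ordinal szn) J (in_tuple s, (Ordinal is_, Ordinal js)).
apply: (avoid h hS idx).
  by apply/and3P; split=> //; apply/allP => ab /ch_e[lt1 lt2 _]; apply/andP.
apply/subsetP => e; rewrite /A inE => /mapP[ab /ch_e[lt1 lt2 eab] ->].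
rewrite /= !(set_nth_default y0) //; last exact: ltn_trans lt1 lt2.
by case/andP: eab.
Qed.

End Sum.

(** * Parameters *)

Lemma quarter_power_sqr_sqrt (R : realType) (x eps : R) : 0 < x ->
  4 * x `^ (- (1 / 4)) <= eps -> 16 <= eps ^+ 2 * Num.sqrt x.
Proof.
move=> x0; set y := x `^ (1 / 4).
have y0 : 0 < y by rewrite powR_gt0.
have y2 : y ^+ 2 = Num.sqrt x.
  rewrite -powR12_sqrt ?ltW // -powR_mulrn ?ltW // -powRrM; congr (_ `^ _).
  by field.
rewrite powRN -/y -y2 -ler_pdivlMl // => le; rewrite -exprMn.
have : 4 <= eps * y by rewrite -ler_pdivrMr //; lra.
nra.
Qed.

(** [K] exceeds [2 / eps] by at most 1, and [d] exceeds [sqrt (n / 2)] by at most 1. So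
    [K * d ^ 2 > n / eps > q]. Of the [eps * n] vertices spared by [q], the quotient [n %/ K] uses
    at most half and the path about [3 / 7]. *)
Lemma waiter_parameters (R : realType) (n t q : nat) (eps : R) :
  16 <= eps ^+ 2 * Num.sqrt n%:R -> 0 < eps < 1 ->
  t%:R <= eps ^+ 2 * Num.sqrt n%:R / 5 -> q%:R <= (1 - eps) * n%:R ->
  exists K d : nat, (q < K * d * d)%N /\
    (t * (d * K) + n %/ K + q + 1 <= n)%N.
Proof.
set r := Num.sqrt n%:R => ge16 /andP[e0 e1] le_t le_q.
have r0 : 0 <= r by apply: sqrtr_ge0.
have r2 : r ^+ 2 = n%:R by rewrite sqr_sqrtr.
have a16 : 16 <= eps * r by nra.
have r16 : 16 <= r by nra.
have /andP[] := truncn_itv (ltW (divr_gt0 (ltr0n R 2) e0)).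
set K0 := Num.truncn _; rewrite -(natr1 K0) => leK ltK.
set K : R := K0%:R + 1 in ltK.
have lK : 2 < K * eps by rewrite -ltr_pdivrMr.
have uK : K * eps <= 3.
  by move: leK; rewrite ler_pdivlMr // /K; lra.
have u0 : 0 <= Num.sqrt (n%:R / 2) :> R by apply: sqrtr_ge0.
have u2 : Num.sqrt (n%:R / 2) ^+ 2 = r ^+ 2 / 2 :> R.
  by rewrite r2 sqr_sqrtr // divr_ge0.
have /andP[] := truncn_itv u0; move: (Num.sqrt _) u0 u2 => u u0 u2.
set d0 := Num.truncn _; rewrite -(natr1 d0) => led ltd.
set d : R := d0%:R + 1 in ltd.
(* [5 / 7] is a rational upper bound for [1 / sqrt 2], as [25 / 49 > 1 / 2]. *)
have ud : d <= 5 / 7 * r + 1.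
  have : u <= 5 / 7 * r by nra.
  by rewrite /d; lra.
have K_gt0 : 0 < K by rewrite /K; have := ler0n R K0; lra.
have d_gt0 : 0 < d by lra.
exists K0.+1, d0.+1; split.
  rewrite -(ltr_nat R) !natrM -!(natr1 K0) -!(natr1 d0) -/K -/d.
  have d2 : r ^+ 2 / 2 < d * d by nra.
  have : 2 < K by nra.
  rewrite -r2 in le_q; nra.
rewrite -(ler_nat R) !natrD !natrM -!(natr1 K0) -!(natr1 d0) -/K -/d.
have fl : (n %/ K0.+1)%:R <= eps * r ^+ 2 / 2.
  have : (n %/ K0.+1)%:R * K <= r ^+ 2.
    by rewrite /K natr1 -natrM r2 ler_nat leq_trunc_div.
  move: (_%:R) (ler0n R (n %/ K0.+1)) => m m0 le.
  have : m * (K * eps) <= eps * r ^+ 2 by nra.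
  nra.
have tK : t%:R * K <= 3 / 5 * (eps * r).
  have : t%:R * K <= eps ^+ 2 * r / 5 * K by rewrite ler_pM2r.
  have : eps * r * (K * eps) <= eps * r * 3 by rewrite ler_wpM2l //; lra.
  lra.
have tdK : t%:R * (d * K) <= 3 / 5 * (eps * r) * (5 / 7 * r + 1).
  have -> : t%:R * (d * K) = t%:R * K * d by ring.
  apply: ler_pM => //; last by rewrite ltW.
  by rewrite mulr_ge0 // ltW.
rewrite -r2 in le_q *.
(* The path costs [3 / 7 * eps * r ^ 2 + 3 / 5 * eps * r]; the remaining [eps * r ^ 2 / 14] covers
   the linear term and the 1, since [r] and [eps * r] are at least 16. *)
nra.
Qed.

(** With [l = ln n], [n * d ^ 3 = l ^ 3] and [d <= l]; as [n >= e ^ 2] gives [l >= 2],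
    [l ^ 3 >= 4 * l > 2 + l]. *)
Lemma client_parameters (R : realType) (n : nat) : expR 2 <= n%:R :> R ->
  let d := n%:R `^ (2 / 3) * ln n%:R / n%:R : R in
  0 < d /\ 2 + d < n%:R * d ^+ 3.
Proof.
move=> le_n /=.
have n1 : 1 <= n%:R :> R by apply: le_trans le_n; rewrite -[leLHS]expR0 ler_expR.
have n0 : 0 < n%:R :> R by lra.
have l2 : 2 <= ln n%:R :> R by rewrite -[leLHS]expRK ler_ln ?posrE ?expR_gt0.
have a3 : (n%:R `^ (2 / 3)) ^+ 3 = n%:R ^+ 2 :> R.
  rewrite -!powR_mulrn ?powR_ge0 ?ler0n // -powRrM; congr (_ `^ _).
  by field.
have an : n%:R `^ (2 / 3) <= n%:R :> R.
  by rewrite -[leRHS]powRr1 ?ler_powR //; lra.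
have a0 : 0 < n%:R `^ (2 / 3) :> R by rewrite powR_gt0.
move: (n%:R `^ (2 / 3)) (ln n%:R) a3 an a0 l2 => a l a3 an a0 l2.
split; first by rewrite divr_gt0 // mulr_gt0 //; lra.
have -> : n%:R * (a * l / n%:R) ^+ 3 = l ^+ 3.
  rewrite !exprMn a3 exprVn; field; by rewrite gt_eqF.
have : a * l / n%:R <= l by rewrite ler_pdivrMr // mulrC ler_pM2l //; lra.
have : 4 * l <= l ^+ 3 by rewrite !exprS expr0; nra.
lra.
Qed.

Theorem theorem1p1 (R : realType) :
  exists n0 : nat, forall n : nat, (n0 <= n)%N ->
    (forall (eps : R) (t q : nat),
       4 * n%:R `^ (- (1 / 4)) <= eps ->
       (0 < t)%N -> t%:R <= eps ^+ 2 * Num.sqrt n%:R / 5 ->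
       (0 < q)%N -> q%:R <= (1 - eps) * n%:R ->
       waiter_can_force (complete_edges n) q
         (fun E => has_complete_minor (graph_of_edges E) t)) /\
    (forall (eta : R) (q : nat),
       n%:R `^ (2 / 3) * ln n%:R <= eta ->
       n%:R + eta <= q%:R ->
       client_can_maintain (complete_edges n) q
         (fun E => ~ has_complete_minor (graph_of_edges E) 4)).
Proof.
exists (Num.truncn (expR 2 : R)).+1 => n le_n.
have e2n : expR 2 <= n%:R :> R.
  have /andP[_ /ltW le_e] := truncn_itv (ltW (expR_gt0 (2 : R))).
  by rewrite (le_trans le_e) // ler_nat.
have n_gt0 : (0 < n)%N by apply: leq_trans le_n.
have n0 : 0 < n%:R :> R by rewrite ltr0n.
pose x0 : 'I_n := Ordinal n_gt0.
split=> [eps t q le_eps t0 le_t q0 le_q | eta q le_eta le_q].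
  have eps0 : 0 < eps by apply: lt_le_trans le_eps; rewrite mulr_gt0 ?powR_gt0.
  (* A positive [q] below [(1 - eps) * n] forces this. *)
  have eps1 : eps < 1.
    have : 0 < (1 - eps) * n%:R by apply: lt_le_trans le_q; rewrite ltr0n.
    by rewrite pmulr_lgt0 // subr_gt0.
  have eps01 : 0 < eps < 1 by rewrite eps0.
  have [K [d [lt_q le_tn]]] :=
    waiter_parameters (quarter_power_sqr_sqrt n0 le_eps) eps01 le_t le_q.
  exact: waiter_forces_minor x0 t0 lt_q le_tn.
have [d0 lt_d] := client_parameters e2n.
apply: (client_avoids_K4 x0 d0) => //.
(* For this [d], [n * (1 + d)] is exactly [n + n ^ (2 / 3) * ln n]. *)
rewrite mulrDr mulr1 mulrCA mulfV ?gt_eqF // mulr1.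
rewrite (le_trans _ (_ : q%:R <= _)) ?ler_nat //.
by rewrite (le_trans _ le_q) // lerD2l.
Qed.
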